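(* Let $A,B\in\mathcal{H}_n([\omega,\Omega])$, let $f$ be a continuous real-valued increasing convex function on $[\omega,\Omega]$, and let $\Phi:\mathcal{M}_n\to\mathcal{M}_m$ be a positive linear map such that either (i) $\Phi$ is unital, i.e. $\Phi(I_n)=I_m$, or (ii) $0\in[\omega,\Omega]$, $f(0)\le 0$ and $\Phi(I_n)\le I_m$. If there is a unitary matrix $U\in\mathcal{M}_m$ such that $$f(t\Phi(A)+(1-t)\Phi(B))\le U\left[t\Phi(f(A))+(1-t)\Phi(f(B))\right]U^*\quad\text{for all } t\in[0,1],$$ then $$\lambda\left(\int_0^1 f(\Phi(tA+(1-t)B))\,dt\right)\le\lambda\left(\frac{\Phi(f(A))+\Phi(f(B))}{2}\right).$$
   Context: $\mathcal{M}_n$ is the algebra of $n\times n$ complex matrices, with identity $I_n$. $\mathcal{H}_n([\omega,\Omega])$ is the set of Hermitian matrices in $\mathcal{M}_n$ whose spectra are contained in the real interval $[\omega,\Omega]$. $f(A)$ is defined by the functional calculus. For Hermitian $A,B$, $A\le B$ means $B-A$ is positive semidefinite. A linear map $\Phi$ is positive if $\Phi(A)\ge 0$ whenever $A\ge 0$. For a Hermitian $A\in\mathcal{M}_m$, $\lambda_1(A)\ge\cdots\ge\lambda_m(A)$ are the eigenvalues of $A$ in decreasing order, counted with multiplicity, and $\lambda(A)=(\lambda_1(A),\dots,\lambda_m(A))$. For Hermitian $A,B\in\mathcal{M}_m$, $\lambda(A)\le\lambda(B)$ means $\lambda_j(A)\le\lambda_j(B)$ for all $1\le j\le m$. *)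

(* Defs.v *)
From HB Require Import structures.
From mathcomp Require Import all_boot all_order all_algebra.
From mathcomp Require Import complex.
From mathcomp Require Import all_classical all_reals all_analysis.

Set Implicit Arguments.
Unset Strict Implicit.
Unset Printing Implicit Defensive.

Import Order.TTheory GRing.Theory Num.Theory.
Import numFieldNormedType.Exports.

Local Open Scope classical_set_scope.
Local Open Scope ring_scope.
Local Open Scope sesquilinear_scope.
Local Open Scope complex_scope.

Definition psdmx (R : realType) (n : nat) (A : 'M[R[i]]_n) : Prop :=
  A \is hermsymmx /\ forall u : 'rV[R[i]]_n, 0 <= (u *m A *m u ^t*) 0 0.

Definition loewner_le (R : realType) (n : nat) (A B : 'M[R[i]]_n) : Prop :=
  psdmx (B - A).

(* In the order of [R[i]], [a%:C <= z] forces [z] to be real. *)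
Definition herm_spec_in (R : realType) (n : nat) (w W : R)
    (A : 'M[R[i]]_n) : Prop :=
  A \is hermsymmx /\ forall z : R[i], eigenvalue A z -> w%:C <= z <= W%:C.

(* Meaningful for Hermitian [A] only: then the eigenvalues are real, and
   [A = invmx (spectralmx A) *m diag_mx (spectral_diag A) *m spectralmx A]
   with [spectralmx A] unitary. *)
Definition funmx (R : realType) (n : nat) (f : R -> R)
    (A : 'M[R[i]]_n) : 'M[R[i]]_n :=
  invmx (spectralmx A)
    *m diag_mx (map_mx (fun z : R[i] => (f (complex.Re z))%:C)
                  (spectral_diag A))
    *m spectralmx A.

Definition positive_map (R : realType) (n m : nat)
    (Phi : 'M[R[i]]_n -> 'M[R[i]]_m) : Prop :=
  forall A : 'M[R[i]]_n, psdmx A -> psdmx (Phi A).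

(* The roots of the characteristic polynomial, listed with multiplicity. *)
Definition eigvals (R : realType) (m : nat) (A : 'M[R[i]]_m) : seq R[i] :=
  sval (closed_field_poly_normal (char_poly A)).

(* Indices start at 0. Real parts are taken only to land in [R]: the
   eigenvalues of a Hermitian matrix are real. *)
Definition lambda (R : realType) (m : nat) (A : 'M[R[i]]_m) (j : 'I_m) : R :=
  nth 0 (sort >=%R [seq complex.Re z | z <- eigvals A]) j.

(* Entrywise integral. *)
Definition integral01_mx (R : realType) (m : nat)
    (F : R -> 'M[R[i]]_m) : 'M[R[i]]_m :=
  \matrix_(i, j)
    ((\int[lebesgue_measure]_(t in `[0%R, 1%R]) complex.Re (F t i j))
     +i* (\int[lebesgue_measure]_(t in `[0%R, 1%R])
            complex.Im (F t i j))).

(* Main.v *)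
Require Import Defs.
From HB Require Import structures.
From mathcomp Require Import all_boot all_order all_algebra.
From mathcomp Require Import complex.
From mathcomp Require Import all_classical all_reals all_analysis.
From mathcomp Require Import measurable_realfun.
From mathcomp Require Import ring lra.

Set Implicit Arguments.
Unset Strict Implicit.
Unset Printing Implicit Defensive.

Import Order.TTheory GRing.Theory Num.Theory.
Import numFieldNormedType.Exports.

Local Open Scope classical_set_scope.
Local Open Scope ring_scope.
Local Open Scope sesquilinear_scope.
Local Open Scope complex_scope.

(** Put [C t = Phi (t A + (1 - t) B)]. The Loewner inequality
    [f (C t) <= U (t X + (1 - t) Y) U^*], with [X = Phi (f A)] and
    [Y = Phi (f B)], can be integrated over [[0, 1]], which gives
    [\int f (C t) <= U ((X + Y) / 2) U^*]; the eigenvalues are monotone for the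
    Loewner order (Weyl) and invariant under unitary conjugation.

    What has to be justified is that the entries of [f (C t)] are integrable.
    Positivity of [Phi] keeps the spectrum of [C t] inside [[w, W]], so they
    are bounded; they are measurable because the Bernstein polynomials of [f]
    converge pointwise to [f] on [[w, W]], while a polynomial in [C t] has
    polynomial entries. *)

(** * Spectral decomposition and Weyl's monotonicity *)

Section Spectral.
Context {C : numClosedFieldType}.

Lemma hermsymmxP n (A : 'M[C]_n) : reflect (A^t* = A) (A \is hermsymmx).
Proof.
by apply: (iffP (is_hermitianmxP _ _ _)); rewrite expr0 scale1r => /esym.
Qed.

Lemma trmxCD m n (A B : 'M[C]_(m, n)) : (A + B)^t* = A^t* + B^t*.
Proof. by rewrite linearD map_mxD. Qed.

Lemma trmxCM m n p (A : 'M[C]_(m, n)) (B : 'M[C]_(n, p)) :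
  (A *m B)^t* = B^t* *m A^t*.
Proof. by rewrite trmx_mul map_mxM. Qed.

Lemma hermsymmxD n (A B : 'M[C]_n) :
  A \is hermsymmx -> B \is hermsymmx -> A + B \is hermsymmx.
Proof.
by move=> /hermsymmxP hA /hermsymmxP hB; apply/hermsymmxP; rewrite trmxCD hA hB.
Qed.

Lemma hermsymmxZ n (a : C) (A : 'M[C]_n) :
  a \is Num.real -> A \is hermsymmx -> a *: A \is hermsymmx.
Proof.
move=> /CrealP ra /hermsymmxP hA; apply/hermsymmxP.
by rewrite linearZ /= map_mxZ hA; congr (_ *: _); exact: ra.
Qed.

Lemma hermsymmx_conj n (U A : 'M[C]_n) :
  A \is hermsymmx -> U *m A *m U^t* \is hermsymmx.
Proof.
by move=> /hermsymmxP hA; apply/hermsymmxP; rewrite !trmxCM trmxCK hA mulmxA.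
Qed.

Lemma hermsymmx_spectral n (A : 'M[C]_n) : A \is hermsymmx ->
  A = (spectralmx A)^t* *m diag_mx (spectral_diag A) *m spectralmx A.
Proof.
move=> /hermitian_normalmx /orthomx_spectralP.
by rewrite invmx_unitary ?spectral_unitarymx.
Qed.

Lemma spectral_diag_real n (A : 'M[C]_n) k :
  A \is hermsymmx -> spectral_diag A 0 k \is Num.real.
Proof. by move=> /hermitian_spectral_diag_real /mxOverP /(_ 0 k). Qed.

(** The rows of [spectralmx A] are orthonormal eigenvectors, so distinct ones span a space on which
    [A] acts diagonally, with the selected eigenvalues. *)
Lemma spectral_rowsub n p (A : 'M[C]_n) (f : 'I_p -> 'I_n) :
  A \is hermsymmx -> injective f ->
  let M := rowsub f (spectralmx A) in
  M \is unitarymx /\ M *m A *m M^t* = diag_mx (colsub f (spectral_diag A)).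
Proof.
move=> hA fI M; have PP := unitarymxP (spectral_unitarymx A).
(* Taking [D = 1] gives orthonormality, taking [D = A] gives the compression. *)
have ME (D : 'M[C]_n) :
    M *m D *m M^t* = mxsub f f (spectralmx A *m D *m (spectralmx A)^t*).
  by rewrite mxsub_mul -mul_rowsub_mx trmx_mxsub map_mxsub.
split.
  apply/unitarymxP; have := ME 1%:M; rewrite !mulmx1 PP => ->.
  by apply/matrixP => i j; rewrite !mxE (inj_eq fI).
rewrite ME [X in _ *m X *m _]hermsymmx_spectral // !mulmxA PP mul1mx.
rewrite -mulmxA PP mulmx1; apply/matrixP => i j.
by rewrite !mxE (inj_eq fI).
Qed.

Lemma quad_diag n (d : 'rV[C]_n) (u : 'rV[C]_n) :
  (u *m diag_mx d *m u^t*) 0 0 = \sum_k d 0 k * `|u 0 k| ^+ 2.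
Proof.
rewrite mul_mx_diag !mxE; apply: eq_bigr => k _.
by rewrite !mxE normCK mulrCA mulrA.
Qed.

Lemma quad1 n (u : 'rV[C]_n) : (u *m u^t*) 0 0 = \sum_k `|u 0 k| ^+ 2.
Proof. by rewrite !mxE; apply: eq_bigr => k _; rewrite !mxE normCK. Qed.

Lemma quadB n (A B : 'M[C]_n) (u : 'rV[C]_n) :
  (u *m (A - B) *m u^t*) 0 0 = (u *m A *m u^t*) 0 0 - (u *m B *m u^t*) 0 0.
Proof. by rewrite mulmxBr mulmxBl mxE; congr (_ + _); exact: mxE. Qed.

Lemma quad_linear n (a b : C) (A B : 'M[C]_n) (u : 'rV[C]_n) :
  (u *m (a *: A + b *: B) *m u^t*) 0 0 =
  a * (u *m A *m u^t*) 0 0 + b * (u *m B *m u^t*) 0 0.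
Proof.
rewrite mulmxDr mulmxDl -!scalemxAr -!scalemxAl mxE.
by congr (_ + _); rewrite mxE.
Qed.

Lemma quad_spectral n (A : 'M[C]_n) (u : 'rV[C]_n) : A \is hermsymmx ->
  (u *m A *m u^t*) 0 0 =
  \sum_k spectral_diag A 0 k * `|(u *m (spectralmx A)^t*) 0 k| ^+ 2.
Proof.
move=> hA; rewrite -quad_diag trmxCM trmxCK !mulmxA.
by rewrite [in LHS](hermsymmx_spectral hA) !mulmxA.
Qed.

Lemma norm_spectral n (A : 'M[C]_n) (u : 'rV[C]_n) :
  (u *m u^t*) 0 0 = \sum_k `|(u *m (spectralmx A)^t*) 0 k| ^+ 2.
Proof.
rewrite -quad1 trmxCM trmxCK mulmxA.
by rewrite mulmxKtV ?spectral_unitarymx.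
Qed.

Lemma quad_rowsub n p (A : 'M[C]_n) (f : 'I_p -> 'I_n) (x : 'rV[C]_p) :
  A \is hermsymmx -> injective f ->
  let v := x *m rowsub f (spectralmx A) in
  (v *m A *m v^t*) 0 0 = \sum_k spectral_diag A 0 (f k) * `|x 0 k| ^+ 2 /\
  (v *m v^t*) 0 0 = \sum_k `|x 0 k| ^+ 2.
Proof.
move=> hA fI v; have [uM MAM] := spectral_rowsub hA fI.
rewrite /v trmxCM; split.
  rewrite !mulmxA -(mulmxA x) -(mulmxA x) MAM quad_diag.
  by apply: eq_bigr => k _; rewrite mxE.
by rewrite !mulmxA mulmxtVK // quad1.
Qed.

(** The one-row case of [quad_rowsub]: a unit eigenvector, used as a test vector to locate an
    eigenvalue. *)
Lemma quad_spectral_row n (A : 'M[C]_n) k : A \is hermsymmx ->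
  exists2 v : 'rV_n, (v *m A *m v^t*) 0 0 = spectral_diag A 0 k &
    (v *m v^t*) 0 0 = 1.
Proof.
move=> hA; have fI : injective (fun _ : 'I_1 => k) by move=> i j; rewrite !ord1.
have [e1 e2] := quad_rowsub 1%:M hA fI.
exists (1%:M *m rowsub (fun _ : 'I_1 => k) (spectralmx A)).
  by rewrite e1 big_ord1 mxE normr1 expr1n mulr1.
by rewrite e2 big_ord1 mxE normr1 expr1n.
Qed.

Lemma spectral_diag_eigenvalue n (A : 'M[C]_n) k : A \is hermsymmx ->
  eigenvalue A (spectral_diag A 0 k).
Proof.
move=> hA; apply/eigenvalueP; exists (row k (spectralmx A)).
  rewrite -row_mul {2}(hermsymmx_spectral hA) !mulmxA.
  rewrite (unitarymxP (spectral_unitarymx A)) mul1mx mul_diag_mx.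
  by apply/rowP => j; rewrite !mxE.
(* A zero row would contradict its unit norm, the [(k, k)] entry of [P P^* = 1]. *)
apply/eqP => /rowP r0.
have /matrixP /(_ k k) := unitarymxP (spectral_unitarymx A).
rewrite !mxE eqxx big1 => [/esym/eqP|j _]; first by rewrite oner_eq0.
by have := r0 j; rewrite !mxE => ->; rewrite mul0r.
Qed.

(* Otherwise the spans of the two families of eigenvectors would meet, and a
   common nonzero vector [v] would satisfy [c |v|^2 < v A v^* <= v B v^*
   <= c |v|^2]. *)
Lemma card_spectral_le n (A B : 'M[C]_n) (c : C) :
  A \is hermsymmx -> B \is hermsymmx ->
  (forall u : 'rV_n, (u *m A *m u^t*) 0 0 <= (u *m B *m u^t*) 0 0) ->
  (#|[pred k | (c < spectral_diag A 0 k)%R]|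
   + #|[pred k | (spectral_diag B 0 k <= c)%R]| <= n)%N.
Proof.
move=> hA hB leAB; rewrite leqNgt; apply/negP.
set S := [pred k | _ < _]; set T := [pred k | _ <= _] => lt_n.
pose M := rowsub (enum_val : 'I_#|S| -> 'I_n) (spectralmx A).
pose N := rowsub (enum_val : 'I_#|T| -> 'I_n) (spectralmx B).
have [uM _] := spectral_rowsub hA (@enum_val_inj _ (mem S)).
have [uN _] := spectral_rowsub hB (@enum_val_inj _ (mem T)).
(* The two ranks add up to more than [n], while the sum of the row spaces has rank at most [n]. *)
have : (M :&: N)%MS != 0.
  rewrite -mxrank_eq0 -lt0n -(ltn_add2l (\rank (M + N)%MS)) addn0.
  rewrite mxrank_sum_cap (mxrank_unitary uM) (mxrank_unitary uN).
  exact: leq_ltn_trans (rank_leq_col _) lt_n.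
move=> /rowV0Pn[v]; rewrite sub_capmx => /andP[/submxP[x vx] /submxP[y vy]] v0.
have [eA nA] := quad_rowsub x hA (@enum_val_inj _ (mem S)).
have [eB nB] := quad_rowsub y hB (@enum_val_inj _ (mem T)).
have x0 : x != 0 by apply: contra v0 => /eqP x0; rewrite vx x0 mul0mx.
have ltA : c * (v *m v^t*) 0 0 < (v *m A *m v^t*) 0 0.
  rewrite vx eA nA mulr_sumr.
  have ge k : true -> 0 <= (spectral_diag A 0 (enum_val k) - c) * `|x 0 k| ^+ 2.
    move=> _; rewrite mulr_ge0 ?exprn_ge0 // subr_ge0 ltW //.
    by have := enum_valP k; rewrite inE.
  (* For strictness: if this sum of nonnegative terms vanished, so would every coordinate of [x], as
     the selected eigenvalues all exceed [c]. *)
  rewrite -subr_gt0 -sumrB; under eq_bigr do rewrite -mulrBl.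
  rewrite lt_def sumr_ge0 // andbT; apply: contra x0 => /eqP.
  move=> /(psumr_eq0P ge) s0; apply/eqP/rowP => k; rewrite mxE.
  have /eqP := s0 k isT; rewrite mulf_eq0 subr_eq0 sqrf_eq0 normr_eq0.
  case/orP=> [/eqP e|/eqP //].
  by have := enum_valP k; rewrite inE e ltxx.
have leB : (v *m B *m v^t*) 0 0 <= c * (v *m v^t*) 0 0.
  rewrite vy eB nB mulr_sumr; apply: ler_sum => k _.
  by rewrite ler_wpM2r ?exprn_ge0 //; have := enum_valP k; rewrite inE.
by have := lt_le_trans ltA (le_trans (leAB v) leB); rewrite ltxx.
Qed.

Lemma char_poly_similar n (P A : 'M[C]_n) : P \in unitmx ->
  char_poly (invmx P *m A *m P) = char_poly A.
Proof.
move=> uP; rewrite /char_poly /char_poly_mx.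
have PQ : map_mx polyC (invmx P) *m map_mx polyC P = 1%:M.
  by rewrite -map_mxM mulVmx // map_mx1.
have -> : 'X%:M - map_mx polyC (invmx P *m A *m P) =
    map_mx polyC (invmx P) *m ('X%:M - map_mx polyC A) *m map_mx polyC P.
  rewrite mulmxBr mulmxBl !map_mxM scalar_mxC -(mulmxA 'X%:M) PQ.
  by rewrite mulmx1.
by rewrite !det_mulmx mulrAC -det_mulmx PQ det1 mul1r.
Qed.

Lemma char_poly_spectral n (A : 'M[C]_n) : A \is hermsymmx ->
  char_poly A = \prod_k ('X - (spectral_diag A 0 k)%:P).
Proof.
move=> hA; rewrite [in LHS](hermsymmx_spectral hA).
rewrite -invmx_unitary ?spectral_unitarymx //.
rewrite char_poly_similar ?spectral_unit //.
rewrite char_poly_trig ?diag_mx_is_trig //.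
by apply: eq_bigr => k _; rewrite mxE eqxx.
Qed.
End Spectral.

(** * Ordered eigenvalues and their monotonicity *)

Section Lambda.
Context {R : realType}.
Local Notation C := R[i].

Definition spec_Re m (A : 'M[C]_m) : seq R :=
  [seq complex.Re (spectral_diag A 0 k) | k : 'I_m].

(** Both lists split the characteristic polynomial into monic linear factors, and such a
    factorisation is unique up to order. *)
Lemma perm_eigvals m (A : 'M[C]_m) : A \is hermsymmx ->
  perm_eq [seq complex.Re z | z <- eigvals A] (spec_Re A).
Proof.
move=> hA; have -> : spec_Re A =
    map (@complex.Re R) [seq spectral_diag A 0 k | k <- enum 'I_m].
  by rewrite -map_comp.
apply: perm_map.
apply: prod_XsubC_eq; rewrite big_map /eigvals.
case: closed_field_poly_normal => r /= e.
move: e; rewrite (monicP (char_poly_monic A)) scale1r => <-.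
by rewrite char_poly_spectral // big_enum.
Qed.

Lemma lambda_spec m (A : 'M[C]_m) j : A \is hermsymmx ->
  lambda A j = nth 0 (sort >=%R (spec_Re A)) j.
Proof.
move=> hA; rewrite /lambda.
have sortP := perm_sortP (@ge_total _ R) (@ge_trans _ R) (@ge_anti _ R).
by have /sortP -> := perm_eigvals hA.
Qed.

(** [lambda] is read off the characteristic polynomial, a similarity invariant. *)
Lemma lambda_unitary m (U A : 'M[C]_m) j : U \is unitarymx ->
  lambda (U *m A *m U^t*) j = lambda A j.
Proof.
move=> uU; rewrite /lambda /eigvals.
have uU' : U^t* \is unitarymx by rewrite trmxC_unitary.
have -> : U *m A *m U^t* = invmx (U^t*) *m A *m U^t*.
  by rewrite (invmx_unitary uU') trmxCK.
by rewrite char_poly_similar // unitarymx_unit.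
Qed.

Lemma count_spec_Re m (A : 'M[C]_m) (p : pred R) :
  count p (spec_Re A) = #|[pred k | p (complex.Re (spectral_diag A 0 k))]|.
Proof. by rewrite count_map -sum1_card -sum1_count big_enum_cond. Qed.

Lemma nth_sort_ge (s : seq R) i j : (i <= j)%N -> (j < size (sort >=%R s))%N ->
  nth 0 (sort >=%R s) j <= nth 0 (sort >=%R s) i.
Proof.
move=> ij js; have ss : sorted >=%R (sort >=%R s).
  exact: sort_sorted (@ge_total _ R) s.
have /= := sorted_leq_nth (@ge_trans _ R) (@ge_refl _ R) 0 ss.
by move=> /(_ i j); rewrite !inE js (leq_ltn_trans ij js) => /(_ isT isT ij).
Qed.

(** If [b_j < a_j], then for [c = b_j] at least [j + 1] eigenvalues of [A] exceed [c] and at least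
    [m - j] eigenvalues of [B] are at most [c]. That makes [m + 1] in all, against
    [card_spectral_le]. *)
Lemma loewner_le_lambda m (A B : 'M[C]_m) j :
  A \is hermsymmx -> B \is hermsymmx -> loewner_le A B ->
  lambda A j <= lambda B j.
Proof.
move=> hA hB [_ psdBA]; rewrite leNgt; apply/negP; rewrite !lambda_spec //.
set a := sort _ (spec_Re A); set b := sort _ (spec_Re B) => ltba.
have sa : size a = m by rewrite size_sort size_image card_ord.
have sb : size b = m by rewrite size_sort size_image card_ord.
have := @card_spectral_le _ _ A B (nth 0 b j)%:C hA hB.
have -> : #|[pred k | (nth 0 b j)%:C < spectral_diag A 0 k]| =
    count (> nth 0 b j) a.
  rewrite (permP (permEl (perm_sort _ _))) count_spec_Re; apply: eq_card => k.
  by rewrite !inE -[spectral_diag A 0 k]RRe_real ?spectral_diag_real //= ltcR.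
have -> : #|[pred k | spectral_diag B 0 k <= (nth 0 b j)%:C]| =
    count (<= nth 0 b j) b.
  rewrite (permP (permEl (perm_sort _ _))) count_spec_Re; apply: eq_card => k.
  by rewrite !inE -[spectral_diag B 0 k]RRe_real ?spectral_diag_real //= lecR.
(* Positions [0] to [j] of the decreasing list [a] hold values at least [a_j > b_j]. *)
have cA : (j < count (> (nth 0 b j : R))%R a)%N.
  rewrite -(cat_take_drop j.+1 a) count_cat ltn_addr //.
  have : all (> nth 0 b j) (take j.+1 a).
    apply/(all_nthP 0) => i; rewrite size_take sa.
    have ij : (minn j.+1 m <= j.+1)%N by rewrite geq_minl.
    rewrite -/(minn _ _) => /leq_trans /(_ ij) lei; rewrite nth_take //.
    by apply: lt_le_trans ltba _; apply: nth_sort_ge; rewrite ?sa ?lei.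
  by rewrite all_count size_take sa => /eqP ->;
    rewrite -/(minn _ _) leq_min leqnn ltn_ord.
pose p : pred R := <= nth 0 b j.
(* Positions from [j] on in [b] hold values at most [b_j]. *)
have cB : (m - j <= count p b)%N.
  rewrite -(cat_take_drop j b) count_cat.
  have : all p (drop j b).
    apply/(all_nthP 0) => i; rewrite size_drop sb nth_drop => lti.
    by apply: nth_sort_ge; rewrite ?leq_addr // sb -ltn_subRL.
  by rewrite all_count size_drop sb => /eqP ->; rewrite leq_addl.
have leAB (u : 'rV_m) : (u *m A *m u^t*) 0 0 <= (u *m B *m u^t*) 0 0.
  by have := psdBA u; rewrite quadB subr_ge0.
move=> /(_ leAB); apply/negP; rewrite -ltnNge.
apply: leq_trans (leq_add cA cB).
by rewrite addSn subnKC // ltnW.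
Qed.
End Lambda.

(** * Positive semidefinite matrices and functional calculus *)

Section PsdSpectrum.
Context {R : realType}.
Local Notation C := R[i].

Lemma realc (a : R) : a%:C \is Num.real.
Proof. by rewrite complex_real eqxx. Qed.

Lemma psdmxD n (A B : 'M[C]_n) : psdmx A -> psdmx B -> psdmx (A + B).
Proof.
move=> [hA pA] [hB pB]; split=> [|u]; first exact: hermsymmxD.
by rewrite mulmxDr mulmxDl mxE addr_ge0.
Qed.

Lemma psdmxZ n (a : R) (A : 'M[C]_n) : 0 <= a -> psdmx A -> psdmx (a%:C *: A).
Proof.
move=> a0 [hA pA]; split=> [|u]; first exact: hermsymmxZ (realc a) hA.
by rewrite -scalemxAr -scalemxAl mxE mulr_ge0 ?ler0c.
Qed.

Lemma hermsymmx_scalar n (a : R) : (a%:C%:M : 'M[C]_n) \is hermsymmx.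
Proof.
rewrite -scalemx1.
exact: hermsymmxZ (realc a) (hermitian1mx_subproof n).
Qed.

Lemma quad_sub_scalar n (A : 'M[C]_n) (c : C) (u : 'rV[C]_n) :
  A \is hermsymmx ->
  (u *m (A - c%:M) *m u^t*) 0 0 =
  \sum_k (spectral_diag A 0 k - c) * `|(u *m (spectralmx A)^t*) 0 k| ^+ 2.
Proof.
move=> hA; rewrite quadB quad_spectral //.
under [RHS]eq_bigr do rewrite mulrBl.
rewrite sumrB; congr (_ + _).
by rewrite mul_mx_scalar -scalemxAl mxE (norm_spectral A) mulr_sumr.
Qed.

(** Turns a spectral inclusion into Loewner bounds, the form that a positive linear map
    transports. *)
Lemma herm_spec_in_psdmx n (w W : R) (A : 'M[C]_n) : herm_spec_in w W A ->
  psdmx (A - w%:C%:M) /\ psdmx (W%:C%:M - A).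
Proof.
move=> [hA sA].
have hs (a b : R) : a%:C *: A + b%:C%:M \is hermsymmx.
  apply: hermsymmxD; first exact: hermsymmxZ (realc a) hA.
  exact: hermsymmx_scalar.
have bd k := sA _ (spectral_diag_eigenvalue k hA).
split; split=> [|u].
- by have := hs 1 (- w); rewrite scale1r rmorphN /= raddfN.
- rewrite quad_sub_scalar //; apply: sumr_ge0 => k _.
  by rewrite mulr_ge0 ?exprn_ge0 // subr_ge0; case/andP: (bd k).
- by have := hs (- 1) W; rewrite rmorphN scaleN1r addrC.
- rewrite -opprB mulmxN mulNmx mxE quad_sub_scalar // oppr_ge0.
  apply: sumr_le0 => k _.
  by rewrite mulr_le0_ge0 ?exprn_ge0 // subr_le0; case/andP: (bd k).
Qed.

(** The way back to the spectrum: both quadratic forms are tested at a unit eigenvector. *)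
Lemma psdmx_spectral_itv n (w W : R) (A : 'M[C]_n) k : A \is hermsymmx ->
  psdmx (A - w%:C%:M) -> psdmx (W%:C%:M - A) ->
  complex.Re (spectral_diag A 0 k) \in `[w, W].
Proof.
move=> hA [_ pw] [_ pW]; have [v e1 e2] := quad_spectral_row k hA.
have q (c : C) : (v *m c%:M *m v^t*) 0 0 = c.
  by rewrite mul_mx_scalar -scalemxAl mxE e2 mulr1.
have := pw v; rewrite quadB (q w%:C) e1 subr_ge0 => wd.
have := pW v; rewrite quadB (q W%:C) e1 subr_ge0 => dW.
move: wd dW; rewrite -[spectral_diag A 0 k]RRe_real ?spectral_diag_real //.
by rewrite !lecR in_itv /= => -> ->.
Qed.

(** Positivity gives [w Phi(1) <= Phi(A) <= W Phi(1)], which settles the unital case. Otherwise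
    [w <= 0 <= W] and [1 - Phi(1) >= 0]; adding [-w (1 - Phi(1))] and [W (1 - Phi(1))] to the two
    differences replaces [Phi(1)] by the identity. *)
Lemma positive_map_bounds n m (Phi : {linear 'M[C]_n -> 'M[C]_m}) (w W : R)
    (A : 'M[C]_n) :
  positive_map Phi ->
  Phi 1%:M = 1%:M \/ 0 \in `[w, W] /\ loewner_le (Phi 1%:M) 1%:M ->
  herm_spec_in w W A ->
  psdmx (Phi A - w%:C%:M) /\ psdmx (W%:C%:M - Phi A).
Proof.
move=> pPhi hPhi /herm_spec_in_psdmx[/pPhi pw /pPhi pW].
have PhiS (c : C) : Phi c%:M = c *: Phi 1%:M.
  by rewrite -[c%:M]scalemx1; exact: linearZZ.
have PhiB (X Y : 'M[C]_n) : Phi (X - Y) = Phi X - Phi Y by exact: linearB.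
move: pw pW; rewrite (PhiB A) (PhiB _ A) (PhiS w%:C) (PhiS W%:C) => pw pW.
case: hPhi => [h1|[]].
  by rewrite -[w%:C%:M]scalemx1 -[W%:C%:M]scalemx1 -h1.
rewrite in_itv /= => /andP[w0 W0] le1.
have w0' : 0 <= - w by rewrite oppr_ge0.
have e (a : C) : a *: (1%:M - Phi 1%:M) = a%:M - a *: Phi 1%:M.
  by rewrite scalerBr scalemx1.
split.
- have := psdmxD pw (psdmxZ w0' le1).
  rewrite e rmorphN scaleNr opprK addrCA subrK addrC.
  by rewrite raddfN addrC.
- have := psdmxD (psdmxZ W0 le1) pW.
  by rewrite e addrA subrK.
Qed.

End PsdSpectrum.

(** * Algebraic rules of the functional calculus *)

Section FunMx.
Context {R : realType}.
Local Notation C := R[i].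
Context {n : nat}.
Implicit Types (A : 'M[C]_n) (f g : R -> R).

Definition fdiag f A : 'M[C]_n :=
  diag_mx (map_mx (fun z : C => (f (complex.Re z))%:C) (spectral_diag A)).

Lemma funmxE f A : funmx f A = (spectralmx A)^t* *m fdiag f A *m spectralmx A.
Proof. by rewrite /funmx invmx_unitary ?spectral_unitarymx. Qed.

Lemma funmx_herm f A : funmx f A \is hermsymmx.
Proof.
rewrite funmxE -{2}[spectralmx A]trmxCK; apply: hermsymmx_conj.
apply/hermsymmxP; rewrite /fdiag tr_diag_mx map_diag_mx; congr diag_mx.
by apply/rowP => k; rewrite !mxE; apply/CrealP; exact: realc.
Qed.

Lemma funmxM f g A : funmx f A *m funmx g A = funmx (fun x => f x * g x) A.
Proof.
have uP := spectral_unitarymx A.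
have FG : fdiag f A *m fdiag g A = fdiag (fun x => f x * g x) A.
  rewrite /fdiag mulmx_diag; congr diag_mx.
  by apply/rowP => k; rewrite !mxE rmorphM.
rewrite 3!funmxE; move: (spectralmx A) uP => P /unitarymxP uP.
rewrite -FG -[P^t* *m _ *m P]mulmxA -!mulmxA; congr (_ *m (_ *m _)).
by rewrite !mulmxA uP mul1mx.
Qed.

Lemma funmxD f g A : funmx f A + funmx g A = funmx (fun x => f x + g x) A.
Proof.
have FG : fdiag f A + fdiag g A = fdiag (fun x => f x + g x) A.
  rewrite /fdiag -raddfD /=; congr diag_mx.
  by apply/rowP => k; rewrite !mxE rmorphD.
rewrite 3!funmxE -FG; move: (fdiag f A) (fdiag g A) => F G.
by rewrite mulmxDr mulmxDl.
Qed.

Lemma funmx_cst c A : funmx (fun=> c) A = c%:C%:M.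
Proof.
rewrite funmxE /fdiag.
have -> : map_mx (fun=> c%:C) (spectral_diag A) = const_mx c%:C.
  by apply/rowP => k; rewrite !mxE.
rewrite diag_const_mx mul_mx_scalar -scalemxAl.
rewrite -invmx_unitary ?spectral_unitarymx //.
by rewrite mulVmx ?spectral_unit // scalemx1.
Qed.

(** The calculus of the identity function returns [A] itself, by the spectral decomposition of a
    Hermitian matrix. *)
Lemma funmx_affine a b A : A \is hermsymmx ->
  funmx (fun x => a * x + b) A = a%:C *: A + b%:C%:M.
Proof.
move=> hA; rewrite -funmxD -funmxM !funmx_cst mul_scalar_mx.
congr (_ *: _ + _); rewrite [in RHS](hermsymmx_spectral hA) funmxE.
do 2 congr (_ *m _); congr diag_mx.
by apply/rowP => k; rewrite mxE RRe_real ?spectral_diag_real.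
Qed.

(** Entries are linear in the values of [f] at the eigenvalues, so limits and bounds of these values
    pass to the entries. *)
Lemma funmx_entry f A i j : funmx f A i j =
  \sum_k (f (complex.Re (spectral_diag A 0 k)))%:C *
    (conjc (spectralmx A k i) * spectralmx A k j).
Proof.
rewrite funmxE /fdiag mul_mx_diag !mxE; apply: eq_bigr => k _.
by rewrite !mxE mulrCA mulrA.
Qed.

End FunMx.

(** * Bernstein polynomials *)

Section Bernstein.
Context {R : realType}.
Implicit Types (g h : nat -> R) (y : R).

(* [bern n g y] is [\sum_k 'C(n, k) y^k (1 - y)^(n - k) g k], that is, the
   expectation of [g] under the binomial distribution. *)
Fixpoint bern n g y : R :=
  if n is n'.+1 then
    (1 - y) * bern n' g y + y * bern n' (fun k => g k.+1) y
  else g 0%N.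

(** The binomial weights are nonnegative on [[0, 1]] and charge only [k <= n]. *)
Lemma bern_le n g h y : 0 <= y <= 1 ->
  (forall k, (k <= n)%N -> g k <= h k) -> bern n g y <= bern n h y.
Proof.
move=> /andP[y0 y1]; elim: n g h => [|n IH] g h gh /=; first exact: gh.
apply: lerD; apply: ler_wpM2l => //; rewrite ?subr_ge0 //; apply: IH => k kn.
  by apply: gh; rewrite leqW.
exact: gh.
Qed.

(** The weights sum to one. *)
Lemma bern_affine n g a b y :
  bern n (fun k => a + b * g k) y = a + b * bern n g y.
Proof. by elim: n g => [//|n IH] g /=; rewrite !IH; ring. Qed.

(** Second moment of the binomial law about [a]: squared bias plus variance. *)
Lemma bern_sqr n a y :
  bern n (fun k => (k%:R - a) ^+ 2) y =
  (n%:R * y - a) ^+ 2 + n%:R * y * (1 - y).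
Proof.
elim: n a => [|n IH] a /=; first by ring.
(* The shift of [k] moves the centre to [a - 1], hence an induction over all [a]. *)
have -> : bern n (fun k => (k.+1%:R - a) ^+ 2) y =
    bern n (fun k => (k%:R - (a - 1)) ^+ 2) y.
  by congr bern; apply/funext => k; rewrite -natr1; congr (_ ^+ 2); ring.
by rewrite !IH -natr1; ring.
Qed.

(** Bernstein's argument: [|f z - f x| <= e/2 + K (z - x)^2] on the interval, and the binomial
    average of the quadratic term is of order [1/N]. The degree [n.+1] keeps the nodes well
    defined. *)
Lemma bern_cvg (w W : R) (f : R -> R) (x : R) :
  {within `[w, W], continuous f} ->
  {in `[w, W] &, {homo f : x y / x <= y}} ->
  x \in `[w, W] ->
  bern n.+1 (fun k => f (w + (W - w) * (k%:R / n.+1%:R))) ((x - w) / (W - w))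
    @[n --> \oo] --> f x.
Proof.
move=> fc fh xI; have := xI; rewrite in_itv /= => /andP[wx xW].
set L := W - w; set y := (x - w) / L.
have L0 : 0 <= L by rewrite subr_ge0 (le_trans wx).
(* If [w = W], the convention [0^-1 = 0] gives [y = 0], and [x = w]. *)
have xE : x = w + L * y.
  rewrite /y; have [L00|Ln0] := eqVneq L 0.
    by rewrite L00 mul0r addr0; move: L00; rewrite /L => ?; lra.
  by field.
have y0 : 0 <= y by rewrite divr_ge0 // subr_ge0.
have y1 : y <= 1.
  rewrite /y; have [L00|Ln0] := eqVneq L 0; first by rewrite L00 invr0 mulr0.
  by rewrite ler_pdivrMr ?lt_def ?Ln0 // mul1r lerD2r.
have y01 : 0 <= y <= 1 by rewrite y0.
pose D := f W - f w.
have wI : w \in `[w, W] by rewrite in_itv /= lexx (le_trans wx).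
have WI : W \in `[w, W] by rewrite in_itv /= lexx (le_trans wx).
have fD z : z \in `[w, W] -> `|f z - f x| <= D.
  move=> zI; have := zI; rewrite in_itv /= => /andP[wz zW].
  have := fh _ _ wI zI wz; have := fh _ _ zI WI zW.
  have := fh _ _ wI xI wx; have := fh _ _ xI WI xW.
  by rewrite /D ler_norml; lra.
have D0 : 0 <= D by rewrite subr_ge0 fh // (le_trans wx).
apply/cvgrPdist_le => e e0.
have [d d0 fd] : exists2 d : R, 0 < d & forall z, z \in `[w, W] ->
    `|z - x| < d -> `|f z - f x| <= e / 2.
  have /subspace_continuousP/(_ x xI)/cvgrPdist_le/(_ (e / 2)) := fc.
  rewrite divr_gt0 // => /(_ isT)/nbhs_ballP[d /= d0 hd].
  exists d => // z zI zx.
  by rewrite distrC; apply: hd => //; rewrite /ball /= distrC.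
(* With this [K], [K (z - x)^2 >= D] as soon as [|z - x| >= d]; [D] bounds the oscillation because
   [f] is increasing. *)
pose K := D / d ^+ 2.
have K0 : 0 <= K by rewrite divr_ge0 ?sqr_ge0.
have fK z : z \in `[w, W] -> `|f z - f x| <= e / 2 + K * (z - x) ^+ 2.
  move=> zI; have [zd|dz] := ltP `|z - x| d.
    by apply: le_trans (fd _ zI zd) _; rewrite lerDl mulr_ge0 ?sqr_ge0.
  apply: le_trans (fD _ zI) _; apply: ler_wpDl; first by rewrite divr_ge0 ?ltW.
  rewrite /K -mulrA ler_peMr // mulrC ler_pdivlMr ?exprn_gt0 // mul1r.
  by rewrite -[leRHS]real_normK ?num_real // lerXn2r ?nnegrE // ltW.
near=> n; set N := n.+1.
have N0 : (N%:R : R) != 0 by rewrite pnatr_eq0.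
have N0' : 0 < (N%:R : R) by rewrite ltr0n.
have zI k : (k <= N)%N -> w + L * (k%:R / N%:R) \in `[w, W].
  move=> kN; rewrite in_itv /= lerDl mulr_ge0 ?divr_ge0 //=.
  rewrite -lerBrDl -/L ler_piMr // ler_pdivrMr // mul1r ler_nat //.
pose V := bern N (fun k => (k%:R - N%:R * y) ^+ 2) y.
have VE : V = N%:R * y * (1 - y) by rewrite /V bern_sqr subrr expr0n add0r.
have hz k : K * (w + L * (k%:R / N%:R) - x) ^+ 2 =
    K * L ^+ 2 / N%:R ^+ 2 * (k%:R - N%:R * y) ^+ 2.
  by rewrite xE; field.
(* The average equals [K L^2 y (1 - y) / N], at most [e/2] once [n >= 2 K L^2 / e]. *)
have hV : K * L ^+ 2 / N%:R ^+ 2 * V <= e / 2.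
  rewrite VE.
  have -> : K * L ^+ 2 / N%:R ^+ 2 * (N%:R * y * (1 - y)) =
     (K * L ^+ 2) * (y * (1 - y)) / N%:R by field.
  rewrite ler_pdivrMr //.
  have KL : 0 <= K * L ^+ 2 by rewrite mulr_ge0 ?sqr_ge0.
  have yy : y * (1 - y) <= 1 by nra.
  apply: le_trans (ler_piMr KL yy) _.
  rewrite -ler_pdivrMl ?divr_gt0 //.
  apply: (@le_trans _ _ n%:R); last by rewrite ler_nat.
  by near: n; exact: nbhs_infty_ger.
(* The two-sided bound at the nodes is averaged by monotonicity of [bern]. *)
rewrite distrC ler_distl; apply/andP; split.
  have /(bern_le y01) : forall k, (k <= N)%N ->
     (f x - e / 2) + - (K * L ^+ 2 / N%:R ^+ 2) * (k%:R - N%:R * y) ^+ 2 <=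
      f (w + L * (k%:R / N%:R)).
    move=> k /zI kI; have := fK _ kI; rewrite hz ler_distl.
    by rewrite mulNr; lra.
  by rewrite bern_affine -/V mulNr; apply: le_trans; lra.
have /(bern_le y01) : forall k, (k <= N)%N ->
   f (w + L * (k%:R / N%:R)) <=
     (f x + e / 2) + (K * L ^+ 2 / N%:R ^+ 2) * (k%:R - N%:R * y) ^+ 2.
  by move=> k /zI kI; have := fK _ kI; rewrite hz ler_distl; lra.
by rewrite bern_affine -/V => /le_trans; apply; lra.
Unshelve. all: by end_near.
Qed.

End Bernstein.

(** * Measurability *)

Section MeasurableMx.
Context {R : realType}.
Local Notation C := R[i].

Definition measurable_mx p q (F : R -> 'M[C]_(p, q)) : Prop :=
  forall i j, measurable_fun setT (fun t => complex.Re (F t i j)) /\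
              measurable_fun setT (fun t => complex.Im (F t i j)).

Lemma cReD (x y : C) : complex.Re (x + y) = complex.Re x + complex.Re y.
Proof. by case: x y => [a b] [c d]. Qed.

Lemma cImD (x y : C) : complex.Im (x + y) = complex.Im x + complex.Im y.
Proof. by case: x y => [a b] [c d]. Qed.

Lemma cReM (x y : C) : complex.Re (x * y) =
  complex.Re x * complex.Re y - complex.Im x * complex.Im y.
Proof. by case: x y => [a b] [c d]. Qed.

Lemma cImM (x y : C) : complex.Im (x * y) =
  complex.Re x * complex.Im y + complex.Im x * complex.Re y.
Proof. by case: x y => [a b] [c d] /=; rewrite addrC. Qed.

Lemma cRe_sum I (r : seq I) (F : I -> C) :
  complex.Re (\sum_(i <- r) F i) = \sum_(i <- r) complex.Re (F i).
Proof. by apply: (big_morph _ cReD). Qed.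

Lemma cIm_sum I (r : seq I) (F : I -> C) :
  complex.Im (\sum_(i <- r) F i) = \sum_(i <- r) complex.Im (F i).
Proof. by apply: (big_morph _ cImD). Qed.

Lemma measurable_mx_cst p q (A : 'M[C]_(p, q)) : measurable_mx (fun=> A).
Proof. by move=> i j; split; exact: measurable_cst. Qed.

Lemma measurable_mxD p q (F G : R -> 'M[C]_(p, q)) :
  measurable_mx F -> measurable_mx G -> measurable_mx (fun t => F t + G t).
Proof.
move=> mF mG i j; have [F1 F2] := mF i j; have [G1 G2] := mG i j.
split; [under eq_fun do rewrite mxE cReD|under eq_fun do rewrite mxE cImD].
  exact: measurable_funD.
exact: measurable_funD.
Qed.

Lemma measurable_mxM p q r (F : R -> 'M[C]_(p, q)) (G : R -> 'M[C]_(q, r)) :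
  measurable_mx F -> measurable_mx G -> measurable_mx (fun t => F t *m G t).
Proof.
move=> mF mG i j.
split; [under eq_fun do rewrite mxE cRe_sum
       |under eq_fun do rewrite mxE cIm_sum];
  apply: measurable_sum => k; have [F1 F2] := mF i k; have [G1 G2] := mG k j.
  under eq_fun do rewrite cReM.
  by apply: measurable_funB; exact: measurable_funM.
under eq_fun do rewrite cImM.
by apply: measurable_funD; exact: measurable_funM.
Qed.

Lemma measurable_mx_scalar p (h : R -> R) :
  measurable_fun setT h -> measurable_mx (fun t => (h t)%:C%:M : 'M[C]_p).
Proof.
move=> mh i j; split; under eq_fun do rewrite mxE; case: (i == j) => /=;
  by [|exact: measurable_cst].
Qed.

(** The recursion of [bern] at a matrix argument, with scalars written as scalar matrices so that
    closure under sums and products yields measurability. *)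
Fixpoint bernmx m n (g : nat -> R) (Y : 'M[C]_m) : 'M[C]_m :=
  if n is n'.+1 then
    (1%:M + (-1)%:M *m Y) *m bernmx n' g Y + Y *m bernmx n' (fun k => g k.+1) Y
  else (g 0%N)%:C%:M.

Lemma measurable_bernmx m n g (Y : R -> 'M[C]_m) :
  measurable_mx Y -> measurable_mx (fun t => bernmx n g (Y t)).
Proof.
move=> mY; elim: n g => [|n IH] g /=; first exact: measurable_mx_cst.
apply: measurable_mxD; apply: measurable_mxM; [|exact: IH|exact: mY|exact: IH].
apply: measurable_mxD; first exact: measurable_mx_cst.
by apply: measurable_mxM => //; exact: measurable_mx_cst.
Qed.

Lemma bernmx_funmx m n g (y : R -> R) (A : 'M[C]_m) :
  bernmx n g (funmx y A) = funmx (fun x => bern n g (y x)) A.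
Proof.
elim: n g => [|n IH] g /=; first by rewrite funmx_cst.
have -> : 1%:M + (-1)%:M *m funmx y A = funmx (fun x => 1 - y x) A.
  have -> : (fun x => 1 - y x) = (fun x => 1 + -1 * y x).
    by apply/funext => x; rewrite mulN1r.
  rewrite -(funmxD (fun=> 1) (fun x => -1 * y x)) -(funmxM (fun=> -1) y).
  rewrite (funmx_cst 1) (funmx_cst (-1)).
  by rewrite (_ : (-1)%:C = -1 :> C) ?(rmorphN1 (real_complex R)).
rewrite IH (IH (fun k => g k.+1)) (funmxM (fun x => 1 - y x)).
rewrite (funmxM y); exact: funmxD.
Qed.

(** Measurability in [t] of the chosen eigenvectors is avoided: the entries are pointwise limits of
    those of Bernstein polynomials in [F t], which are polynomial in the entries of [F t]. *)
Lemma measurable_funmx m (w W : R) (f : R -> R) (F : R -> 'M[C]_m) :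
  {within `[w, W], continuous f} ->
  {in `[w, W] &, {homo f : x y / x <= y}} ->
  measurable_mx F ->
  forall i j (D : set R), measurable D ->
  (forall t, D t -> F t \is hermsymmx) ->
  (forall t k, D t -> complex.Re (spectral_diag (F t) 0 k) \in `[w, W]) ->
  measurable_fun D (fun t => complex.Re (funmx f (F t) i j)) /\
  measurable_fun D (fun t => complex.Im (funmx f (F t) i j)).
Proof.
move=> fc fh mF i j D mD hF sF.
(* The affine change of variable from [[w, W]] to [[0, 1]], in the shape of [funmx_affine]. *)
pose y x : R := (W - w)^-1 * x + - ((W - w)^-1 * w).
pose g n k := f (w + (W - w) * (k%:R / n.+1%:R)).
pose Y t := (W - w)^-1%:C%:M *m F t + (- ((W - w)^-1 * w))%:C%:M.
have mY : measurable_mx Y.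
  apply: measurable_mxD; last exact: measurable_mx_cst.
  by apply: measurable_mxM => //; exact: measurable_mx_cst.
have YE t : D t -> Y t = funmx y (F t).
  by move=> Dt; rewrite /y funmx_affine ?hF // /Y mul_scalar_mx.
have mB n := measurable_bernmx n.+1 (g n) mY i j.
have cB t k : D t -> bern n.+1 (g n) (y (complex.Re (spectral_diag (F t) 0 k)))
    @[n --> \oo] --> f (complex.Re (spectral_diag (F t) 0 k)).
  move=> Dt; have := bern_cvg fc fh (sF t k Dt).
  by rewrite /y -mulrN -mulrDr mulrC.
split.
- apply: (@measurable_fun_cvg _ _ _ _
      (fun n t => complex.Re (bernmx n.+1 (g n) (Y t) i j))).
    by move=> n; apply: measurable_funTS; exact: (mB n).1.
  move=> t Dt; under eq_fun do rewrite YE // bernmx_funmx funmx_entry cRe_sum.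
  rewrite funmx_entry cRe_sum; apply: (cvg_big add_continuous) => k _.
  under eq_fun do rewrite cReM /= mul0r subr0.
  by rewrite cReM /= mul0r subr0; apply: cvgMr_tmp; exact: cB.
- apply: (@measurable_fun_cvg _ _ _ _
      (fun n t => complex.Im (bernmx n.+1 (g n) (Y t) i j))).
    by move=> n; apply: measurable_funTS; exact: (mB n).2.
  move=> t Dt; under eq_fun do rewrite YE // bernmx_funmx funmx_entry cIm_sum.
  rewrite funmx_entry cIm_sum; apply: (cvg_big add_continuous) => k _.
  under eq_fun do rewrite cImM /= mul0r addr0.
  by rewrite cImM /= mul0r addr0; apply: cvgMr_tmp; exact: cB.
Qed.

Lemma cRe_Im_le (z : C) (e : R) : `|z| <= e%:C ->
  `|complex.Re z| <= e /\ `|complex.Im z| <= e.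
Proof.
case: z => a b; rewrite normc_def lecR /= => he.
have sq (x y : R) : `|x| <= Num.sqrt (x ^+ 2 + y ^+ 2).
  by rewrite -sqrtr_sqr ler_sqrt ?addr_ge0 ?sqr_ge0 // lerDl sqr_ge0.
by split; apply: le_trans he; rewrite // addrC.
Qed.

Lemma norm_unitarymx_entry m (P : 'M[C]_m) i j :
  P \is unitarymx -> `|P i j| <= 1.
Proof.
move=> /unitarymxP /matrixP /(_ i i); rewrite !mxE eqxx mulr1n (bigD1 j) //=.
rewrite !mxE -normCK => e; rewrite -(@ler_pXn2r _ 2) ?nnegrE // expr1n -e lerDl.
by apply: sumr_ge0 => k _; rewrite !mxE -normCK exprn_ge0.
Qed.

(** The entry is a sum of [m] terms, each at most [M] in modulus since entries of a unitary matrix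
    have modulus at most one. *)
Lemma funmx_entry_le m (f : R -> R) (M : R) (A : 'M[C]_m) i j :
  (forall k, `|f (complex.Re (spectral_diag A 0 k))| <= M) ->
  `|complex.Re (funmx f A i j)| <= M *+ m /\
  `|complex.Im (funmx f A i j)| <= M *+ m.
Proof.
move=> fM; apply: cRe_Im_le; rewrite funmx_entry.
apply: le_trans (ler_norm_sum _ _ _) _.
have -> : (M *+ m)%:C = \sum_(k < m) M%:C :> C.
  by rewrite sumr_const card_ord -rmorphMn.
apply: ler_sum => k _; rewrite normrM.
have e1 : `|(f (complex.Re (spectral_diag A 0 k)))%:C| <= M%:C :> C.
  by rewrite normc_def /= expr0n addr0 sqrtr_sqr lecR.
have u a := norm_unitarymx_entry k a (spectral_unitarymx A).
rewrite -[M%:C]mulr1; apply: ler_pM => //.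
by rewrite normrM -[1]mulr1; apply: ler_pM => //; rewrite norm_conjC.
Qed.

End MeasurableMx.

(** * Integration *)

Section Integral01.
Context {R : realType}.
Local Notation C := R[i].
Local Notation mu := (@lebesgue_measure R).
Local Notation I01 := (`[0%R, 1%R]%classic : set R).

Lemma bounded_integrable01 (g : R -> R) (K : R) : measurable_fun I01 g ->
  (forall t, 0 <= t <= 1 -> `|g t| <= K) -> mu.-integrable I01 (EFin \o g).
Proof.
move=> mg gK; apply: measurable_bounded_integrable => //.
  by rewrite [X in (X < _)%E]lebesgue_measure_itv /= lte_fin ltr01 sube0 ltry.
exists K; split=> [|M KM t /= t01]; first exact: num_real.
by apply: le_trans (ltW KM); exact: gK.
Qed.

(** Integrability is bundled with the value, so that linearity composes without side conditions. *)
Definition has_int (g : R -> R) (v : R) : Prop :=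
  mu.-integrable I01 (EFin \o g) /\ \int[mu]_(t in `[0%R, 1%R]) g t = v.

Lemma has_intD g h u v : has_int g u -> has_int h v ->
  has_int (fun t => g t + h t) (u + v).
Proof.
move=> [ig <-] [ih <-]; split; last by rewrite RintegralD.
have -> : EFin \o (fun t => g t + h t) = (EFin \o g) \+ (EFin \o h).
  by apply/funext.
exact: integrableD.
Qed.

Lemma has_intZ a g u : has_int g u -> has_int (fun t => a * g t) (a * u).
Proof.
move=> [ig <-]; split; last by rewrite RintegralZl.
have -> : EFin \o (fun t => a * g t) = (fun t => a%:E * (EFin \o g) t)%E.
  by apply/funext.
exact: integrableZl.
Qed.

Lemma has_int_cst a : has_int (fun=> a) a.
Proof.
split.
  by apply: (@bounded_integrable01 _ `|a|) => [|//]; exact: measurable_cst.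
rewrite Rintegral_cst // [X in fine X]lebesgue_measure_itv /=.
by rewrite lte_fin ltr01 sube0 mulr1.
Qed.

Lemma has_int_id : has_int id 2^-1.
Proof.
split.
  apply: (@bounded_integrable01 _ 1) => [|t /andP[t0 t1]].
    exact: measurable_id.
  by rewrite ger0_norm.
pose F : R -> R := 2^-1 \*: (@id R ^+ 2).
have dF (t : R) : is_derive t 1 F t.
  by apply: is_derive_eq; rewrite expr1 /GRing.scale /= mulr1 mulKf.
have cF (t : R) : {for t, continuous F}.
  by apply/differentiable_continuous/derivable1_diffP; case: (dF t).
rewrite /Rintegral (@continuous_FTC2 _ id F) //.
- rewrite /F /= !exprfctE expr1n expr0n scaler0 /= subr0.
  by rewrite /GRing.scale /= mulr1.
- by apply: continuous_subspaceT => t; exact: cvg_id.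
- split=> [t _||].
  + by case: (dF t).
  + by apply: cvg_at_right_filter; exact: cF.
  + by apply: cvg_at_left_filter; exact: cF.
- by move=> t _; rewrite derive1E; case: (dF t).
Qed.

Lemma has_int_uniq g u v : has_int g u -> has_int g v -> u = v.
Proof. by move=> [_ <-] [_ <-]. Qed.

Lemma has_int_le g h u v : has_int g u -> has_int h v ->
  (forall t, 0 <= t <= 1 -> g t <= h t) -> u <= v.
Proof.
by move=> [ig <-] [ih <-] gh; apply: le_Rintegral.
Qed.

Lemma eq_has_int g h v : (forall t, 0 <= t <= 1 -> g t = h t) ->
  has_int g v -> has_int h v.
Proof.
move=> gh [ig <-]; split.
  apply: eq_integrable ig => // t; rewrite inE /= in_itv /= => t01.
  by rewrite gh.
by apply: eq_Rintegral => t; rewrite inE /= in_itv /= => t01; rewrite gh.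
Qed.

(** * Integrals of complex and matrix functions *)

Definition has_cint (F : R -> C) (z : C) : Prop :=
  has_int (fun t => complex.Re (F t)) (complex.Re z) /\
  has_int (fun t => complex.Im (F t)) (complex.Im z).

Lemma has_cintM c F z : has_cint F z -> has_cint (fun t => c * F t) (c * z).
Proof.
move=> [r i]; split.
  rewrite cReM -mulNr; under eq_fun do rewrite cReM -mulNr.
  by apply: has_intD; exact: has_intZ.
rewrite cImM; under eq_fun do rewrite cImM.
by apply: has_intD; exact: has_intZ.
Qed.

Lemma has_cint_sum I (s : seq I) (F : I -> R -> C) (z : I -> C) :
  (forall i, has_cint (F i) (z i)) ->
  has_cint (fun t => \sum_(i <- s) F i t) (\sum_(i <- s) z i).
Proof.
move=> hF; elim: s => [|i s IH].
  rewrite big_nil; under eq_fun do rewrite big_nil.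
  by split; exact: has_int_cst.
rewrite big_cons; under eq_fun do rewrite big_cons.
have [r1 i1] := hF i; have [r2 i2] := IH; split.
  by rewrite cReD; under eq_fun do rewrite cReD; exact: has_intD.
by rewrite cImD; under eq_fun do rewrite cImD; exact: has_intD.
Qed.

Definition has_mxint p q (F : R -> 'M[C]_(p, q)) (A : 'M[C]_(p, q)) : Prop :=
  forall i j, has_cint (fun t => F t i j) (A i j).

Lemma has_mxintMl p q r (B : 'M[C]_(r, p)) (F : R -> 'M[C]_(p, q)) A :
  has_mxint F A -> has_mxint (fun t => B *m F t) (B *m A).
Proof.
move=> hF i j; rewrite mxE; under eq_fun do rewrite mxE.
by apply: has_cint_sum => k; exact: has_cintM.
Qed.

Lemma has_mxintMr p q r (B : 'M[C]_(q, r)) (F : R -> 'M[C]_(p, q)) A :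
  has_mxint F A -> has_mxint (fun t => F t *m B) (A *m B).
Proof.
move=> hF i j; rewrite mxE; under eq_fun do rewrite mxE.
apply: has_cint_sum => k; rewrite mulrC; under eq_fun do rewrite mulrC.
exact: has_cintM.
Qed.

Lemma has_mxint_integral01 m (F : R -> 'M[C]_m) :
  (forall i j, mu.-integrable I01 (EFin \o (fun t => complex.Re (F t i j)))) ->
  (forall i j, mu.-integrable I01 (EFin \o (fun t => complex.Im (F t i j)))) ->
  has_mxint F (integral01_mx F).
Proof. by move=> hr hi i j; rewrite mxE; split; split. Qed.

(** Entries [(i, j)] and [(j, i)] have conjugate integrands, hence conjugate integrals by
    uniqueness. *)
Lemma has_mxint_herm m (F : R -> 'M[C]_m) A :
  (forall t, 0 <= t <= 1 -> F t \is hermsymmx) -> has_mxint F A ->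
  A \is hermsymmx.
Proof.
move=> hF hA; apply/hermsymmxP/matrixP => i j; rewrite !mxE.
have e t : 0 <= t <= 1 -> F t j i = conjc (F t i j).
  by move=> /hF /hermsymmxP h; rewrite -[in LHS]h !mxE.
have [r1 i1] := hA i j; have [r2 i2] := hA j i.
have er : complex.Re (A i j) = complex.Re (A j i).
  apply: has_int_uniq r2; apply: eq_has_int r1 => t /e ->.
  by case: (F t i j).
have ei : - 1 * complex.Im (A j i) = complex.Im (A i j).
  apply: has_int_uniq i1; apply: eq_has_int (has_intZ (-1) i2) => t /e ->.
  by case: (F t i j) => a b /=; rewrite mulN1r opprK.
change (conjc (A j i) = A i j).
move: er ei; case: (A i j) (A j i) => [a b] [c d] /= -> <-.
by rewrite mulN1r.
Qed.

(** * Quadratic forms and Hermitian images *)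

Lemma herm_quad_real m (A : 'M[C]_m) (u : 'rV[C]_m) :
  A \is hermsymmx -> (u *m A *m u^t*) 0 0 \is Num.real.
Proof.
move=> hA; rewrite quad_spectral //; apply: rpred_sum => k _.
by apply: rpredM; [exact: spectral_diag_real|rewrite ger0_real ?exprn_ge0].
Qed.

(** Quadratic forms of Hermitian matrices are real, so comparing real parts suffices and reduces the
    matter to real integrals. *)
Lemma loewner_le_Re m (A B : 'M[C]_m) : A \is hermsymmx -> B \is hermsymmx ->
  (forall u : 'rV[C]_m, complex.Re ((u *m A *m u^t*) 0 0) <=
    complex.Re ((u *m B *m u^t*) 0 0)) -> loewner_le A B.
Proof.
move=> hA hB le_q; split=> [|u].
  rewrite -scaleN1r; apply: hermsymmxD hB _; apply: hermsymmxZ hA.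
  by rewrite rpredN rpred1.
rewrite quadB subr_ge0 -(RRe_real (herm_quad_real u hA)).
by rewrite -(RRe_real (herm_quad_real u hB)) lecR.
Qed.

(** Slope times [t] plus intercept, ready to be integrated. *)
Lemma Re_quad_conv m (X Y : 'M[C]_m) (v : 'rV[C]_m) (t : R) :
  complex.Re ((v *m (t%:C *: X + (1 - t)%:C *: Y) *m v^t*) 0 0) =
  (complex.Re ((v *m X *m v^t*) 0 0) - complex.Re ((v *m Y *m v^t*) 0 0)) * t
  + complex.Re ((v *m Y *m v^t*) 0 0).
Proof.
rewrite quad_linear.
move: ((v *m X *m (v^t*)) 0 0) ((v *m Y *m (v^t*)) 0 0) => [a a'] [b b'] /=.
by ring.
Qed.

Lemma psdmx_funmx_ge0 m (g : R -> R) (A : 'M[C]_m) : (forall x, 0 <= g x) ->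
  psdmx (funmx g A).
Proof.
move=> g0; split=> [|u]; first exact: funmx_herm.
rewrite funmxE.
have -> : u *m ((spectralmx A)^t* *m fdiag g A *m spectralmx A) *m u^t* =
    (u *m (spectralmx A)^t*) *m fdiag g A *m (u *m (spectralmx A)^t*)^t*.
  by rewrite trmxCM trmxCK !mulmxA.
rewrite quad_diag; apply: sumr_ge0 => k _.
by rewrite mxE mulr_ge0 ?exprn_ge0 // ler0c.
Qed.

(** Split [f] into positive and negative parts [g 1] and [g (-1)]: both give positive semidefinite
    matrices, whose images under [Phi] are Hermitian. *)
Lemma positive_map_funmx_herm n m (Phi : {linear 'M[C]_n -> 'M[C]_m}) f
    (A : 'M[C]_n) : positive_map Phi -> Phi (funmx f A) \is hermsymmx.
Proof.
move=> pPhi; pose g s (x : R) := Num.max 0 (s * f x).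
have hg s : Phi (funmx (g s) A) \is hermsymmx.
  have /pPhi[] // : psdmx (funmx (g s) A).
  by apply: psdmx_funmx_ge0 => x; rewrite /g le_max lexx.
have -> : funmx f A = funmx (g 1) A + (-1)%:C *: funmx (g (-1)) A.
  rewrite -mul_scalar_mx -(funmx_cst (-1) A) funmxM funmxD.
  congr (funmx _ A); apply/funext => x.
  rewrite /g mul1r !mulN1r !maxEle oppr_ge0.
  by have [|/ltW] := leP 0 (f x); case: ltgtP => // *; lra.
rewrite linearD linearZZ; apply: hermsymmxD => //.
exact: hermsymmxZ (realc _) (hg _).
Qed.
End Integral01.

(** * Integrating the Loewner inequality *)

Theorem theorem3p8 (R : realType) (n m : nat) (w W : R) (A B : 'M[R[i]]_n)
  (f : R -> R) (Phi : {linear 'M[R[i]]_n -> 'M[R[i]]_m}) :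
  herm_spec_in w W A ->
  herm_spec_in w W B ->
  {within `[w, W], continuous f} ->
  {in `[w, W] &, {homo f : x y / x <= y}} ->
  convex_function (`[w, W] : set (convex_lmodType R^o)) f ->
  positive_map Phi ->
  Phi 1%:M = 1%:M \/
    [/\ 0 \in `[w, W], f 0 <= 0 & loewner_le (Phi 1%:M) 1%:M] ->
  (exists2 U : 'M[R[i]]_m, U \is unitarymx &
     forall t : R, 0 <= t <= 1 ->
       loewner_le (funmx f (t%:C *: Phi A + (1 - t)%:C *: Phi B))
         (U *m (t%:C *: Phi (funmx f A) + (1 - t)%:C *: Phi (funmx f B))
            *m U ^t*)) ->
  forall j : 'I_m,
    lambda (integral01_mx
              (fun t => funmx f (Phi (t%:C *: A + (1 - t)%:C *: B)))) j
    <= lambda (2^-1 *: (Phi (funmx f A) + Phi (funmx f B))) j.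
Proof.
move=> hA hB fc fh _ pPhi hPhi [U uU hU] j.
have hPhi' : Phi 1%:M = 1%:M \/ 0 \in `[w, W] /\ loewner_le (Phi 1%:M) 1%:M.
  by case: hPhi => [|[]]; [left|right].
have [pAw pAW] := positive_map_bounds pPhi hPhi' hA.
have [pBw pBW] := positive_map_bounds pPhi hPhi' hB.
set X := Phi (funmx f A); set Y := Phi (funmx f B).
pose D t : 'M[R[i]]_m := t%:C *: Phi A + (1 - t)%:C *: Phi B.
have -> : (fun t => funmx f (Phi (t%:C *: A + (1 - t)%:C *: B))) =
    (fun t => funmx f (D t)).
  by apply/funext => t; rewrite linearD !linearZZ.
have comb (P Q : 'M[R[i]]_m) t : 0 <= t <= 1 -> psdmx P -> psdmx Q ->
    psdmx (t%:C *: P + (1 - t)%:C *: Q).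
  by move=> /andP[t0 t1] pP pQ; apply: psdmxD; apply: psdmxZ; rewrite ?subr_ge0.
have scal (c : R[i]) (t : R) :
    t%:C *: c%:M + (1 - t)%:C *: c%:M = c%:M :> 'M[R[i]]_m.
  by rewrite -scalerDl -rmorphD addrC subrK scale1r.
(* Convex combinations of the bounds at the endpoints; the scalar matrix is unchanged because the
   weights sum to one. *)
have Dw t : 0 <= t <= 1 -> psdmx (D t - w%:C%:M).
  move=> t01; have := comb _ _ t t01 pAw pBw.
  by rewrite !scalerBr addrACA -opprD scal.
have DW t : 0 <= t <= 1 -> psdmx (W%:C%:M - D t).
  move=> t01; have := comb _ _ t t01 pAW pBW.
  by rewrite !scalerBr addrACA -opprD scal.
have hD t : 0 <= t <= 1 -> D t \is hermsymmx.
  move=> /Dw [h _]; rewrite -[D t](subrK w%:C%:M).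
  by apply: hermsymmxD h _; exact: hermsymmx_scalar.
have sD t k : 0 <= t <= 1 -> complex.Re (spectral_diag (D t) 0 k) \in `[w, W].
  by move=> t01; apply: psdmx_spectral_itv (hD t t01) (Dw t t01) (DW t t01).
have mD : measurable_mx D.
  have -> : D = (fun t => t%:C%:M *m Phi A + (1 - t)%:C%:M *m Phi B).
    by apply/funext => t; rewrite !mul_scalar_mx.
  apply: measurable_mxD; apply: measurable_mxM;
    [|exact: measurable_mx_cst| |exact: measurable_mx_cst].
    by apply: measurable_mx_scalar; exact: measurable_id.
  apply: measurable_mx_scalar; apply: measurable_funB => //.
set F := (fun t => funmx f (D t)).
(* An increasing [f] lies between its endpoint values. *)
pose M : R := Num.max `|f w| `|f W|.
have fM x : x \in `[w, W] -> `|f x| <= M.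
  rewrite in_itv /= => /andP[wx xW].
  have wI : w \in `[w, W] by rewrite in_itv /= lexx (le_trans wx).
  have WI : W \in `[w, W] by rewrite in_itv /= lexx (le_trans wx).
  have xI : x \in `[w, W] by rewrite in_itv /= wx.
  have f1 := fh _ _ wI xI wx; have f2 := fh _ _ xI WI xW.
  have M1 : `|f w| <= M by rewrite le_max lexx.
  have M2 : `|f W| <= M by rewrite le_max lexx orbT.
  by move: M1 M2; rewrite !ler_norml; lra.
have F_le t i k : 0 <= t <= 1 ->
    `|complex.Re (F t i k)| <= M *+ m /\ `|complex.Im (F t i k)| <= M *+ m.
  by move=> t01; apply: funmx_entry_le => l; apply: fM; exact: sD.
have F_meas i k := measurable_funmx fc fh mD i k (measurable_itv `[0%R, 1%R])
  (fun t (h : `[0%R, 1%R]%classic t) => hD t h) (fun t l h => sD t l h).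
have intF : has_mxint F (integral01_mx F).
  apply: has_mxint_integral01 => i k;
    apply: (@bounded_integrable01 _ _ (M *+ m)).
  - exact: (F_meas i k).1.
  - by move=> t /(F_le t i k)[].
  - exact: (F_meas i k).2.
  - by move=> t /(F_le t i k)[].
have hF t : F t \is hermsymmx by exact: funmx_herm.
have hX : X \is hermsymmx by exact: positive_map_funmx_herm.
have hY : Y \is hermsymmx by exact: positive_map_funmx_herm.
have hI : integral01_mx F \is hermsymmx :=
  has_mxint_herm (fun t _ => hF t) intF.
have half : 2^-1 = (2^-1 : R)%:C :> R[i] by rewrite fmorphV rmorph_nat.
(* Conjugating by [U] keeps the eigenvalues and produces the right-hand side of the integrated
   inequality. *)
rewrite -(lambda_unitary (2^-1 *: (X + Y)) j uU).
have hG : U *m (2^-1 *: (X + Y)) *m U^t* \is hermsymmx.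
  apply: hermsymmx_conj; rewrite half.
  exact: hermsymmxZ (realc _) (hermsymmxD hX hY).
apply: (loewner_le_lambda j hI hG); apply: (loewner_le_Re hI hG) => u.
(* The form of [U Z U^*] at [u] is that of [Z] at [v]. *)
pose v := u *m U.
have qU (Z : 'M[R[i]]_m) : u *m (U *m Z *m U^t*) *m u^t* = v *m Z *m v^t*.
  by rewrite /v trmxCM !mulmxA.
pose x := complex.Re ((v *m X *m v^t*) 0 0).
pose y := complex.Re ((v *m Y *m v^t*) 0 0).
(* The mean is the point [t = 1/2] of the segment; an affine function of [t] has its value there as
   integral over [[0, 1]]. *)
have e : 2^-1 *: (X + Y) = (2^-1)%:C *: X + (1 - 2^-1)%:C *: Y.
  by rewrite scalerDr half (_ : 1 - 2^-1 = 2^-1 :> R) //; lra.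
rewrite qU e Re_quad_conv.
(* For fixed [u], the quadratic form commutes with the entrywise integral, leaving a pointwise
   comparison of real integrands. *)
have [iq _] := has_mxintMr (u^t*) (has_mxintMl u intF) 0 0.
apply: (has_int_le iq (has_intD (has_intZ (x - y) has_int_id) (has_int_cst y))).
move=> t t01; rewrite /x /y -Re_quad_conv -qU.
have [_ /(_ u)] := hU t t01.
by rewrite quadB subr_ge0 lecE => /andP[].
Qed.
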